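(* Let $t \geq 6$ be an integer. Write $\lfloor \sqrt{2^{t+1}} + 0.5\rfloor - 4 = 3a+b$ with $a\in\mathbb{Z}_{\geq 0}$ and $b\in\{0,1,2\}$, put $\varepsilon = \sqrt{2^{t+1}} + 0.5 - \lfloor \sqrt{2^{t+1}} + 0.5\rfloor \in[0,1)$, and define \[ \lambda_{a,b,\varepsilon} = \begin{cases} 1 &\text{ for $a$ odd and $b=0$},\\ 2 &\text{ for $a$ odd, $b=1$ and $0\leq\varepsilon \leq 1-\frac{1}{2^{(t-4)/2}}$},\\ 1 &\text{ for $a$ odd, $b=1$ and $1-\frac{1}{2^{(t-4)/2}} < \varepsilon<1$},\\ 2 &\text{ for $a$ odd and $b=2$},\\ 2 &\text{ for $a$ even, $b=0$ and $0\leq\varepsilon \leq 0.5$},\\ 1 &\text{ for $a$ even, $b=0$ and $0.5<\varepsilon<1$},\\ 2 &\text{ for $a$ even, $b=1$ and $0\leq\varepsilon \leq 1-\frac{1}{2^{(t-5)/2}}$},\\ 1 &\text{ for $a$ even, $b=1$ and $1-\frac{1}{2^{(t-5)/2}} < \varepsilon \leq 1-\frac{1}{2^{(t+7)/2}}$},\\ 0 &\text{ for $a$ even, $b=1$ and $1-\frac{1}{2^{(t+7)/2}} < \varepsilon<1$},\\ 0 &\text{ for $a$ even and $b=2$}. \end{cases} \] Let $n_t = \lfloor \sqrt{2^{t+1}} + 0.5\rfloor - \lambda_{a,b,\varepsilon}$. Then there is no binary linear code of length $n_t$, dimension $n_t - t$ and minimum distance $5$, and consequently \[ s_{\max}(t)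 \leq \begin{cases} 2^{\frac{t+1}{2}} - 2 &\text{ for $t$ odd},\\ \lfloor \sqrt{2^{t+1}} + 0.5\rfloor - \lambda_{a,b,\varepsilon} &\text{ for $t$ even}. \end{cases} \]
   Context: $\mathbb{F}_2^t$ denotes the $t$-dimensional vector space over the binary field $\mathbb{F}_2$. A subset $M\subseteq \mathbb{F}_2^t$ is called Sidon if $m_1+m_2\neq m_3+m_4$ for all pairwise distinct $m_1,m_2,m_3,m_4\in M$. $s_{\max}(t)$ denotes the maximum size of a Sidon set in $\mathbb{F}_2^t$. A binary linear code of length $n$ and dimension $k$ is a $k$-dimensional subspace of $\mathbb{F}_2^n$; its minimum distance is the minimum Hamming weight (number of nonzero entries) of its nonzero codewords. *)

(* Defs.v *)
From HB Require Import structures.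
From mathcomp Require Import all_boot all_order all_algebra.
From mathcomp Require Import reals.
Set Implicit Arguments. Unset Strict Implicit. Unset Printing Implicit Defensive.
Import Order.TTheory GRing.Theory Num.Theory.

Definition wt n (v : 'rV['F_2]_n) : nat := #|[set i | v ord0 i != 0%R]|.

(* The binary linear code given as the row space of C : 'M['F_2]_n
   has length n, dimension k and minimum distance d (= minimum Hamming
   weight of its nonzero codewords). *)
Definition is_code n k d (C : 'M['F_2]_n) : Prop :=
  [/\ \rank C = k,
      (forall v : 'rV['F_2]_n, (v <= C)%MS -> v != 0%R -> (d <= wt v)%N) &
      exists2 v : 'rV['F_2]_n, (v <= C)%MS /\ v != 0%R & wt v = d].

Definition is_sidon t (M : {set 'rV['F_2]_t}) : Prop :=
  forall m1 m2 m3 m4, m1 \in M -> m2 \in M -> m3 \in M -> m4 \in M ->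
    uniq [:: m1; m2; m3; m4] -> (m1 + m2 != m3 + m4)%R.

Definition is_sidonb t (M : {set 'rV['F_2]_t}) : bool :=
  [forall m1 in M, forall m2 in M, forall m3 in M, forall m4 in M,
     uniq [:: m1; m2; m3; m4] ==> (m1 + m2 != m3 + m4)%R].

Definition s_max t : nat := \max_(M : {set 'rV['F_2]_t} | is_sidonb M) #|M|.

Lemma is_sidonP t (M : {set 'rV['F_2]_t}) : reflect (is_sidon M) (is_sidonb M).
Proof.
apply: (iffP idP).
- move=> /forall_inP H m1 m2 m3 m4 h1 h2 h3 h4 u.
  move: (H m1 h1) => /forall_inP /(_ m2 h2) /forall_inP /(_ m3 h3)
    /forall_inP /(_ m4 h4) /implyP; exact.
- move=> H; apply/forall_inP => m1 h1; apply/forall_inP => m2 h2.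
  apply/forall_inP => m3 h3; apply/forall_inP => m4 h4; apply/implyP.
  exact: H.
Qed.

Local Open Scope ring_scope.

(* N_t := floor(sqrt(2^(t+1)) + 0.5) (a positive integer, taken in nat). *)
Definition Nfl (R : realType) (t : nat) : nat :=
  `|Num.floor (Num.sqrt (2 ^+ t.+1 : R) + 2^-1)|%N.

Definition eps (R : realType) (t : nat) : R :=
  Num.sqrt (2 ^+ t.+1 : R) + 2^-1 - (Nfl R t)%:R.

Definition acoef (R : realType) (t : nat) : nat := ((Nfl R t - 4) %/ 3)%N.
Definition bcoef (R : realType) (t : nat) : nat := ((Nfl R t - 4) %% 3)%N.

(* lambda_{a,b,eps}; 2^((t-c)/2) is written Num.sqrt (2^(t-c)). *)
Definition lambda (R : realType) (t a b : nat) (e : R) : nat :=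
  if odd a then
    if b == 0%N then 1%N
    else if b == 1%N then
      (if e <= 1 - (Num.sqrt (2 ^+ (t - 4) : R))^-1 then 2%N else 1%N)
    else 2%N
  else
    if b == 0%N then (if e <= 2^-1 then 2%N else 1%N)
    else if b == 1%N then
      (if e <= 1 - (Num.sqrt (2 ^+ (t - 5) : R))^-1 then 2%N
       else if e <= 1 - (Num.sqrt (2 ^+ (t + 7) : R))^-1 then 1%N
       else 0%N)
    else 0%N.

Definition n_t (R : realType) (t : nat) : nat :=
  (Nfl R t - lambda t (acoef R t) (bcoef R t) (eps R t))%N.

(* Main.v *)
(** Let [M] be a Sidon set with [s] elements in a space of [Q = 2^t] points.
Two triples in [M] with the same sum are disjoint, and no triple sums to an
element of [M], so the ['C(s, 3)] triples are spread over the [Q - s] points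
outside [M], at most [k = s %/ 3] on each.  If [x] carries exactly [k] triples
(call it full), the at most two points of [M] that they leave over have sum
[vsum M + k x], so:
- for [k] odd and [s = 3k], [x] is determined, hence at most one [x] is full;
- for [k] odd and [s = 3k + 1], [x] is determined by the point left over, hence
  at most [s] points are full;
- for [k] even, the sum left over is always [vsum M], and since distinct pairs
  have distinct sums, all full points leave over the same points.  A common
  point [p] left over lies on ['C(s - 1, 2)] triples, which have distinct sums,
  none of them full.
Each case bounds [s (s + c)] by about [2 Q], which excludes [s = n_t + 1].
A code with minimum distance 5 gives a Sidon set with [n + 1] elements: the
columns of a parity check matrix together with 0. *)
Require Import Defs.
From HB Require Import structures.
From mathcomp Require Import all_boot all_order all_algebra.
From mathcomp Require Import reals.
From mathcomp Require Import zify ring lra.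

Set Implicit Arguments. Unset Strict Implicit. Unset Printing Implicit Defensive.
Import Order.TTheory GRing.Theory Num.Theory.

(** * Vectors over the binary field and small binomials *)

Lemma addrr_rV2 t (x : 'rV['F_2]_t) : (x + x = 0)%R.
Proof.
apply/rowP => i; rewrite !mxE; exact: (addrr_pchar2 (pchar_Fp (isT : prime 2))).
Qed.

Lemma oppr_rV2 t (x : 'rV['F_2]_t) : (- x = x)%R.
Proof. by apply/eqP; rewrite eq_sym -addr_eq0 addrr_rV2. Qed.

Lemma mulrn_rV2 t (x : 'rV['F_2]_t) k : (x *+ k = if odd k then x else 0)%R.
Proof.
by elim: k => [|k IH]; rewrite ?mulr0n // mulrS IH /=; case: odd; rewrite ?addrr_rV2 ?addr0.
Qed.

Lemma card_rV2 t : #|{: 'rV['F_2]_t}| = 2 ^ t.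
Proof. by rewrite card_mx card_Fp // mul1n. Qed.

Lemma bin3 n : 6 * 'C(n.+3, 3) = n.+3 * (n.+2 * n.+1).
Proof. by rewrite mulnC bin_ffact !ffactnS ffactn0 muln1. Qed.

Lemma bin2S n : 2 * 'C(n.+2, 2) = n.+2 * n.+1.
Proof. by rewrite mulnC bin_ffact !ffactnS ffactn0 muln1. Qed.

Lemma exists_subset_card (T : finType) (A : {set T}) n :
  n <= #|A| -> exists2 B : {set T}, B \subset A & #|B| = n.
Proof.
rewrite -bin_gt0 -cards_draws card_gt0 => /set0Pn [B].
by rewrite inE => /andP [sBA /eqP]; exists B.
Qed.

Lemma sidonS t (M N : {set 'rV['F_2]_t}) :
  N \subset M -> is_sidon M -> is_sidon N.
Proof. by move=> /subsetP sNM sM m1 m2 m3 m4 /sNM ? /sNM ? /sNM ? /sNM ?; apply: sM. Qed.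

Definition draws (T : finType) (A : {set T}) n := [set B : {set T} | B \subset A & #|B| == n].

(** * Pairs and triples in a Sidon set, sorted by their sums *)

Section Triples.
Variables (t : nat) (M : {set 'rV['F_2]_t}).
Hypothesis sM : is_sidon M.
Local Notation V := 'rV['F_2]_t.
Local Notation vsum A := (\sum_(v in A) v)%R.
Local Open Scope ring_scope.

(** If [m3] is neither [m1] nor [m2], cancellation keeps [m4] away from both too, so the four points
    are distinct and the Sidon property applies. *)
Lemma sidon_pair m1 m2 m3 m4 :
  m1 \in M -> m2 \in M -> m3 \in M -> m4 \in M -> m1 != m2 -> m3 != m4 ->
  m1 + m2 = m3 + m4 -> m3 \in [set m1; m2].
Proof.
move=> i1 i2 i3 i4 n12 n34 E; rewrite !inE.
case: (eqVneq m3 m1) => //= n31; case: (eqVneq m3 m2) => //= n32.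
have n41 : m4 != m1.
  by apply: contraNneq n32 => e41; rewrite e41 addrC in E; rewrite (addIr _ E).
have n42 : m4 != m2.
  by apply: contraNneq n31 => e42; rewrite e42 in E; rewrite (addIr _ E).
have := sM i1 i2 i3 i4; rewrite E eqxx /= !inE !negb_or n12 n34 /=.
by rewrite ![m1 == _]eq_sym ![m2 == _]eq_sym n31 n41 n32 n42 => /(_ isT).
Qed.

Lemma vsum_pair_inj : {in draws M 2 &, injective (fun A : {set V} => vsum A)}.
Proof.
move=> A B; rewrite !inE => /andP [sA cA] /andP [sB cB] /=.
case/cards2P: cA => [m1 [m2 [n12 eA]]]; case/cards2P: cB => [m3 [m4 [n34 eB]]].
rewrite eA eB; move: sA sB; rewrite eA eB !subUset !sub1set => /andP [i1 i2] /andP [i3 i4] /=.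
rewrite !big_setU1 ?inE // !big_set1 => E.
have h3 := sidon_pair i1 i2 i3 i4 n12 n34 E.
have h4 : m4 \in [set m1; m2].
  by apply: (sidon_pair i1 i2 i4 i3 n12); rewrite 1?eq_sym // addrC -[RHS]addrC -E addrC.
have sBA : [set m3; m4] \subset [set m1; m2] by rewrite subUset !sub1set h3.
by apply/eqP; rewrite eq_sym eqEcard sBA !cards2 n12 n34.
Qed.

Lemma vsum_pair_neq0 A : A \in draws M 2 -> vsum A != 0.
Proof.
rewrite inE => /andP [_ /cards2P [m1 [m2 [n12 ->]]]].
by rewrite big_setU1 ?inE // big_set1 addr_eq0 oppr_rV2.
Qed.

Lemma card_sidon_pairs : ('C(#|M|, 2) < 2 ^ t)%N.
Proof.
rewrite -card_rV2 -cards_draws -(card_in_imset vsum_pair_inj) -cardsT.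
rewrite [X in (_ < X)%N](cardsD1 0) inE ltnS; apply: subset_leq_card.
apply/subsetP => x /imsetP [A hA ->]; rewrite !inE andbT; exact: vsum_pair_neq0.
Qed.

Definition triples (x : V) := [set A in draws M 3 | vsum A == x].

Lemma triple_split x A p : A \in triples x -> p \in A ->
  [/\ p \in M, A :\ p \in draws M 2 & vsum (A :\ p) = x + p].
Proof.
rewrite !inE => /andP [/andP [sA /eqP cA] /eqP <-] pA.
rewrite (subsetP sA) // (subset_trans (subD1set _ _) sA) /=; split => //.
  by move: cA; rewrite (cardsD1 p) pA add1n => -[->].
by rewrite [in RHS](big_setD1 p) //= addrAC addrr_rV2 add0r.
Qed.

(** Removing the common point leaves two pairs with the same sum [x + p]. *)
Lemma triples_disjoint x A B p : A \in triples x -> B \in triples x ->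
  p \in A -> p \in B -> A = B.
Proof.
move=> hA hB pA pB; have [_ dA eA] := triple_split hA pA; have [_ dB eB] := triple_split hB pB.
rewrite -(setD1K pA) -(setD1K pB); congr (_ |: _).
by apply: vsum_pair_inj => //; rewrite eA eB.
Qed.

Lemma triples_trivIset x : trivIset (triples x).
Proof.
apply/trivIsetP => A B hA hB; apply: contraR => /pred0Pn [p] /= /andP [pA pB].
by rewrite (triples_disjoint hA hB pA pB).
Qed.

(** If [x] is in the triple, the other two points sum to 0. Otherwise, for [p] in the triple,
    [[set x; p]] and [A :\ p] have equal sums, yet only the first contains [p]. *)
Lemma triples_mem0 x : x \in M -> triples x = set0.
Proof.
move=> xM; apply/eqP; rewrite -subset0; apply/subsetP => A hA; rewrite inE.
have /andP [/andP [sA /eqP cA] _] : (A \subset M) && (#|A| == 3) && (vsum A == x).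
  by move: hA; rewrite !inE.
have [xA|xA] := boolP (x \in A).
  have [_ d e] := triple_split hA xA.
  by move: (vsum_pair_neq0 d); rewrite e addrr_rV2 eqxx.
have /card_gt0P [p pA] : (0 < #|A|)%N by rewrite cA.
have [pM d e] := triple_split hA pA.
have npx : x != p by apply: contraNneq xA => ->.
have d2 : [set x; p] \in draws M 2 by rewrite inE subUset !sub1set xM pM cards2 npx.
have E : [set x; p] = A :\ p.
  by apply: vsum_pair_inj => //; rewrite e big_setU1 ?inE // big_set1.
by move/setP/(_ p): E; rewrite !inE eqxx orbT.
Qed.

Lemma card_cover_triples x : #|cover (triples x)| = (3 * #|triples x|)%N.
Proof.
have /eqP <- := triples_trivIset x.
rewrite (eq_bigr (fun=> 3%N)); first by rewrite sum_nat_const mulnC.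
by move=> A; rewrite !inE => /andP [/andP [_ /eqP]].
Qed.

Lemma cover_triples_sub x : cover (triples x) \subset M.
Proof. by apply/bigcupsP => A; rewrite !inE => /andP [/andP []]. Qed.

Lemma card_triples_le x : (3 * #|triples x| <= #|M|)%N.
Proof. by rewrite -card_cover_triples subset_leq_card ?cover_triples_sub. Qed.

Lemma sum_card_triples : (\sum_(x in ~: M) #|triples x| = 'C(#|M|, 3))%N.
Proof.
rewrite -cards_draws -sum1_card (partition_big (fun A : {set V} => vsum A) predT) //=.
rewrite [RHS](bigID [in M]) /= [X in (X + _)%N]big1 ?add0n => [|x xM].
  by apply: eq_big => [x|x _]; rewrite ?inE // -sum1_card; apply: eq_bigl => A; rewrite !inE.
rewrite (eq_bigl [in triples x]) => [|A]; last by rewrite !inE.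
by rewrite triples_mem0 // big_set0.
Qed.

(** * Left over points and full points *)

Definition leftover x := M :\: cover (triples x).

Lemma card_leftover x : #|leftover x| = (#|M| - 3 * #|triples x|)%N.
Proof. by rewrite cardsDS ?cover_triples_sub // card_cover_triples. Qed.

Lemma vsum_leftover x : vsum (leftover x) = vsum M + x *+ #|triples x|.
Proof.
rewrite [vsum M](big_setID (cover (triples x))) /=.
rewrite (setIidPr (cover_triples_sub x)) (big_trivIset _ (triples_trivIset x)) /=.
rewrite [X in _ = X + _ + _](eq_bigr (fun=> x)) => [|A]; last by rewrite !inE => /andP [_ /eqP].
by rewrite sumr_const addrAC addrr_rV2 add0r.
Qed.

Definition full k := [set x | #|triples x| == k].

Lemma fullC k : (0 < k)%N -> full k \subset ~: M.
Proof.
move=> k0; apply/subsetP => x; rewrite !inE => /eqP e; apply: contraTN k0 => xM.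
by rewrite -e triples_mem0 // cards0.
Qed.

(** The bound on [#|M|] caps every point at [k] triples, so a point outside [M] carries at most
    [k.-1], plus one if it is full. The sum over [~: M] is stated without subtraction. *)
Lemma card_triples_full k : (#|M| < 3 * k + 3)%N -> (0 < k)%N ->
  ('C(#|M|, 3) + (#|M| * k.-1) <= 2 ^ t * k.-1 + #|full k|)%N.
Proof.
move=> hk k0; rewrite -sum_card_triples -card_rV2 -(cardsC M) mulnDl addnC -addnA leq_add2l.
rewrite -sum_nat_const.
have -> : #|full k| = (\sum_(x in ~: M) (x \in full k))%N.
  rewrite -[in LHS](setIidPr (fullC k0)) -sum1_card [RHS]big_mkcond [LHS]big_mkcond.
  by apply: eq_bigr => x _; rewrite !inE; case: (x \in M) => //=; case: eqP.
rewrite -big_split; apply: leq_sum => x _ /=; rewrite inE.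
have := card_triples_le x; case: eqP => /= h le_x; first lia.
by rewrite addn0; move: (#|_|) (#|_|) h le_x hk k0 => a b; lia.
Qed.

(** Each pair in [M :\ p] yields a point [p + vsum A] outside [M]. These points are distinct, and
    none is full because each carries a triple through [p]. *)
Lemma card_full_avoid k p : (0 < k)%N -> p \in M ->
  (forall x, x \in full k -> p \in leftover x) ->
  (#|full k| + 'C(#|M|.-1, 2) + #|M| <= 2 ^ t)%N.
Proof.
move=> k0 pM hp; pose f (A : {set V}) := p + vsum A.
pose P := [set f A | A in draws (M :\ p) 2].
have sD A : A \in draws (M :\ p) 2 -> A \in draws M 2.
  by rewrite !inE => /andP [/subset_trans -> //]; apply: subD1set.
have fP A : A \in draws (M :\ p) 2 -> p |: A \in triples (f A).
  rewrite !inE subsetD1 => /andP [/andP [sAM pA] /eqP cA].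
  by rewrite subUset sub1set pM sAM cardsU1 pA cA big_setU1 /=.
have cP : #|P| = 'C(#|M|.-1, 2).
  rewrite card_in_imset; first by rewrite cards_draws (cardsD1 p M) pM.
  by move=> A B /sD hA /sD hB /addrI; apply: vsum_pair_inj.
have sP : P \subset ~: M.
  apply/subsetP => x /imsetP [A /fP hA ->]; rewrite inE.
  by apply: contraTN hA => /triples_mem0 ->; rewrite inE.
have dP : [disjoint full k & P].
  apply/pred0P => x /=; apply/negP => /andP [hx /imsetP [A /fP hA ex]].
  have := hp _ hx; rewrite inE => /andP [/negP np _]; apply: np.
  by apply/bigcupP; exists (p |: A); rewrite ?ex // !inE eqxx.
rewrite -cP -card_rV2 -(cardsC M) addnC leq_add2l.
move: dP; rewrite -(leq_card_setU (full k) P) => /eqP <-.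
by apply: subset_leq_card; rewrite subUset sP fullC.
Qed.

Lemma card_full_sub k : (0 < k)%N -> (#|full k| + #|M| <= 2 ^ t)%N.
Proof.
by move=> k0; rewrite -card_rV2 -(cardsC M) addnC leq_add2l subset_leq_card ?fullC.
Qed.

Lemma card_full0_odd k : #|M| = (3 * k)%N -> odd k -> (#|full k| <= 1)%N.
Proof.
move=> cM ok; apply: leq_trans (eq_leq (cards1 (vsum M))); apply: subset_leq_card.
apply/subsetP => x; rewrite !inE => /eqP hx.
have : leftover x = set0 by apply/eqP; rewrite -cards_eq0 card_leftover hx cM subnn.
move=> e; have := vsum_leftover x; rewrite e big_set0 hx mulrn_rV2 ok => /esym/eqP.
by rewrite addr_eq0 oppr_rV2 eq_sym.
Qed.

Lemma leftover1 k x : #|M| = (3 * k + 1)%N -> x \in full k ->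
  exists2 p, p \in M & leftover x = [set p].
Proof.
move=> cM; rewrite inE => /eqP hx.
have /eqP/cards1P [p e] : #|leftover x| = 1%N by rewrite card_leftover hx cM addKn.
by exists p => //; have := set11 p; rewrite -e inE => /andP [].
Qed.

Lemma card_full1_odd k : #|M| = (3 * k + 1)%N -> odd k -> (#|full k| <= #|M|)%N.
Proof.
move=> cM ok; apply: leq_trans (leq_imset_card (fun p => p + vsum M) _).
apply: subset_leq_card; apply/subsetP => x hx; have [p pM e] := leftover1 cM hx.
apply/imsetP; exists p => //; have := vsum_leftover x.
move: hx; rewrite e big_set1 inE => /eqP ->; rewrite mulrn_rV2 ok => ->.
by rewrite addrC addrA addrr_rV2 add0r.
Qed.

Lemma full1_even k : #|M| = (3 * k + 1)%N -> ~~ odd k -> (0 < #|full k|)%N ->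
  exists2 p, p \in M & forall x, x \in full k -> p \in leftover x.
Proof.
move=> cM ok /card_gt0P [x0 h0]; have [p pM e] := leftover1 cM h0.
have es x : x \in full k -> vsum (leftover x) = vsum M.
  by rewrite vsum_leftover inE => /eqP ->; rewrite mulrn_rV2 (negPf ok) addr0.
exists p => // x hx; have [q qM e'] := leftover1 cM hx.
by have := es _ hx; rewrite -(es _ h0) e e' !big_set1 => ->; rewrite inE.
Qed.

Lemma full2_even k : #|M| = (3 * k + 2)%N -> ~~ odd k -> (0 < #|full k|)%N ->
  exists2 p, p \in M & forall x, x \in full k -> p \in leftover x.
Proof.
move=> cM ok /card_gt0P [x0 h0].
have es x : x \in full k -> vsum (leftover x) = vsum M.
  by rewrite vsum_leftover inE => /eqP ->; rewrite mulrn_rV2 (negPf ok) addr0.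
have ed x : x \in full k -> leftover x \in draws M 2.
  by rewrite !inE card_leftover => /eqP ->; rewrite subsetDl cM addKn.
have /card_gt0P [p hp] : (0 < #|leftover x0|)%N.
  by have := ed _ h0; rewrite inE => /andP [_ /eqP ->].
exists p; first by move: hp; rewrite inE => /andP [].
move=> x hx; suff -> : leftover x = leftover x0 by [].
by apply: vsum_pair_inj; rewrite ?ed //= !es.
Qed.

(** * Bounds on the size of a Sidon set, by residue mod 3 and parity *)

Local Open Scope nat_scope.
Local Notation s := #|M|.

Lemma sidon_bound : 1 < s -> s * s.-1 + 2 <= 2 * 2 ^ t.
Proof.
have := card_sidon_pairs; case: s => [|[|n]] // h _.
by have := bin2S n; rewrite /=; lia.
Qed.

Lemma sidon_bound_mod2 k : s = 3 * k + 2 -> 0 < k -> s * s.+1 <= 2 * 2 ^ t.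
Proof.
case: k => // k cM _; have {}cM : s = (3 * k + 2).+3 by rewrite cM; lia.
(* Full points are only known to lie outside [M] here. In this and the next proofs the goal is
   multiplied by the coefficient of [Q] left in the counting inequality, times 3. *)
have hC := card_triples_full (k := k.+1); have hF := card_full_sub (ltn0Sn k).
have := bin3 (3 * k + 2); move: hC hF; rewrite cM /=.
move: (2 ^ t) #|full _| ('C(_, 3)) => Q F C hC hF eC.
have {}hC : C + (3 * k + 2).+3 * k <= Q * k + F by apply: hC; lia.
by rewrite -(leq_pmul2l (ltn0Sn (3 * k + 2))); lia.
Qed.

Lemma sidon_bound_mod0_odd k : s = 3 * k -> odd k -> 1 < k -> s * s.+2 + 2 <= 2 * 2 ^ t.
Proof.
move=> cM ok; have hF := card_full0_odd cM ok; case: k cM hF {ok} => [|[|k]] // cM hF _.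
have {}cM : s = (3 * k + 3).+3 by rewrite cM; lia.
have hC := card_triples_full (k := k.+2).
have := bin3 (3 * k + 3); move: hC hF; rewrite cM /=.
move: (2 ^ t) #|full _| ('C(_, 3)) => Q F C hC hF eC.
have {}hC : C + (3 * k + 3).+3 * k.+1 <= Q * k.+1 + F by apply: hC; lia.
by rewrite -(leq_pmul2l (ltn0Sn (3 * k + 2))); lia.
Qed.

Lemma sidon_bound_mod1_odd k : s = 3 * k + 1 -> odd k -> 1 < k -> s * (s + 3) <= 2 * 2 ^ t.
Proof.
move=> cM ok; have hF := card_full1_odd cM ok; case: k cM hF {ok} => [|[|k]] // cM hF _.
have {}cM : s = (3 * k + 4).+3 by rewrite cM; lia.
have hC := card_triples_full (k := k.+2).
have := bin3 (3 * k + 4); move: hC hF; rewrite cM /=.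
move: (2 ^ t) #|full _| ('C(_, 3)) => Q F C hC hF eC.
have {}hC : C + (3 * k + 4).+3 * k.+1 <= Q * k.+1 + F by apply: hC; lia.
by rewrite -(leq_pmul2l (ltn0Sn (3 * k + 2))); lia.
Qed.

Lemma sidon_bound_mod1_even k : s = 3 * k + 1 -> ~~ odd k -> 1 < k ->
  s * (s + 3) <= 2 * 2 ^ t + 6.
Proof.
move=> cM ok; have hF := full1_even cM ok; case: k cM hF {ok} => [|[|k]] // cM hF _.
have {}cM : s = (3 * k + 4).+3 by rewrite cM; lia.
have hC := card_triples_full (k := k.+2).
have := bin3 (3 * k + 4); have := bin2S (3 * k + 4); move: hC.
(* With a full point, adding [hC] and [hD] leaves [Q] with coefficient [k.+2]; without one it is
   [k.+1]. Hence the two different multipliers. *)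
have [F0|/hF [p pM hp]] := posnP #|full k.+2|; last first.
  have := card_full_avoid (ltn0Sn _) pM hp; rewrite cM /=.
  move: (2 ^ t) #|full _| ('C(_, 2)) ('C(_, 3)) => Q F D C hD hC eD eC.
  have {}hC : C + (3 * k + 4).+3 * k.+1 <= Q * k.+1 + F by apply: hC; lia.
  by rewrite -(leq_pmul2l (ltn0Sn (3 * k + 5))); lia.
rewrite F0 cM /=; move: (2 ^ t) ('C(_, 2)) ('C(_, 3)) => Q D C hC _ eC.
have {}hC : C + (3 * k + 4).+3 * k.+1 <= Q * k.+1 + 0 by apply: hC; lia.
by rewrite -(leq_pmul2l (ltn0Sn (3 * k + 2))); lia.
Qed.

Lemma sidon_bound_mod2_even k : s = 3 * k + 2 -> ~~ odd k -> 1 < k ->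
  s * (s + 4) <= 2 * 2 ^ t + 3.
Proof.
move=> cM ok; have hF := full2_even cM ok; case: k cM hF {ok} => [|[|k]] // cM hF _.
have {}cM : s = (3 * k + 5).+3 by rewrite cM; lia.
have hC := card_triples_full (k := k.+2).
have := bin3 (3 * k + 5); have := bin2S (3 * k + 5); move: hC.
have [F0|/hF [p pM hp]] := posnP #|full k.+2|; last first.
  have := card_full_avoid (ltn0Sn _) pM hp; rewrite cM /=.
  move: (2 ^ t) #|full _| ('C(_, 2)) ('C(_, 3)) => Q F D C hD hC eD eC.
  have {}hC : C + (3 * k + 5).+3 * k.+1 <= Q * k.+1 + F by apply: hC; lia.
  by rewrite -(leq_pmul2l (ltn0Sn (3 * k + 5))); lia.
rewrite F0 cM /=; move: (2 ^ t) ('C(_, 2)) ('C(_, 3)) => Q D C hC _ eC.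
have {}hC : C + (3 * k + 5).+3 * k.+1 <= Q * k.+1 + 0 by apply: hC; lia.
by rewrite -(leq_pmul2l (ltn0Sn (3 * k + 2))); lia.
Qed.

End Triples.

(** * From codes to Sidon sets *)

(** [cokermx C] has kernel [C] and rank [t], so its column base has exactly [t] columns and the same
    kernel. The matrix is transposed: its rows are the usual parity check columns. *)
Lemma parity_check (F : fieldType) n t (C : 'M[F]_n) : \rank C + t = n ->
  exists H : 'M[F]_(n, t), forall v : 'rV_n, (v *m H = 0)%R -> (v <= C)%MS.
Proof.
move=> rC; have rK : \rank (cokermx C) = t by rewrite mxrank_coker; apply/eqP; rewrite -(eqn_add2l (\rank C)) subnKC ?rank_leq_row ?rC.
rewrite -rK; exists (col_base (cokermx C)) => v vH.
by rewrite submxE -[cokermx C]mulmx_base mulmxA vH mul0mx.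
Qed.

Lemma code_sidon t n (C : 'M['F_2]_n) : is_code (n - t)%N 5 C ->
  exists2 M : {set 'rV['F_2]_t}, is_sidon M & #|M| = n.+1.
Proof.
move=> [rC dC [v0 [v0C v0n] _]].
(* A nonzero codeword makes the rank positive, so [n - t] is not truncated. *)
have tn : \rank C + t = n.
  rewrite rC subnK // ltnW // -subn_gt0 -rC lt0n mxrank_eq0.
  by apply: contraNneq v0n => C0; rewrite C0 submx0 in v0C.
have [H hH] := parity_check tn.
pose f (o : option 'I_n) : 'rV['F_2]_t := if o is Some i then row i H else 0%R.
(* A vanishing sum of at most four points gives a codeword of weight below 5, hence 0. [None], which
   stands for the added vector 0, may remain in [B]. Sizes 2 and 4 then give injectivity and the
   Sidon property. *)
have f0 (B : {set option 'I_n}) : #|B| <= 4 -> (\sum_(o in B) f o = 0)%R -> #|B| <= 1.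
  move=> B4 sB; pose A := [set i | Some i \in B].
  have AB : #|A| <= #|B|.
    rewrite -(card_imset (mem A) (@Some_inj _)); apply: subset_leq_card.
    by apply/subsetP => o /imsetP [i]; rewrite inE => iB ->.
  pose v : 'rV['F_2]_n := (\row_i (i \in A)%:R)%R.
  have wv : wt v = #|A|.
    by apply: eq_card => i; rewrite !inE mxE inE; case: (_ \in B).
  have vC : (v <= C)%MS.
    apply: hH; rewrite mulmx_sum_row -[RHS]sB.
    transitivity (\sum_(o in Some @: A) f o)%R.
      rewrite (big_imset _ (in2W (@Some_inj _))) [RHS]big_mkcond /=.
      by apply: eq_bigr => i _; rewrite mxE; case: ifP; rewrite ?scale1r ?scale0r.
    rewrite big_mkcond [RHS]big_mkcond; apply: eq_bigr => -[i|] _; last by rewrite !if_same.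
    by rewrite mem_imset ?inE //; apply: Some_inj.
  have v0E : v = 0%R.
    by apply/eqP; apply: contraTT (leq_trans AB B4) => vn0; rewrite -ltnNge -wv dC.
  apply: leq_trans (eq_leq (cards1 (@None 'I_n))); apply: subset_leq_card.
  apply/subsetP => -[i|] iB; rewrite inE //.
  by move/rowP/(_ i): v0E; rewrite !mxE inE iB.
have fI : injective f.
  move=> o1 o2 e; apply/eqP/negPn/negP => n12.
  have := f0 [set o1; o2]; rewrite cards2 n12 big_setU1 ?inE // big_set1 e.
  by move=> /(_ isT (addrr_rV2 _)).
exists (f @: setT); last by rewrite card_imset // cardsT card_option card_ord.
move=> m1 m2 m3 m4 /imsetP [o1 _ ->] /imsetP [o2 _ ->] /imsetP [o3 _ ->] /imsetP [o4 _ ->].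
rewrite -[[:: f o1; f o2; f o3; f o4]]/(map f [:: o1; o2; o3; o4]) map_inj_uniq // => u.
apply/eqP => e; have := f0 [set o in [:: o1; o2; o3; o4]].
rewrite cardsE (card_uniqP u) => /(_ isT).
rewrite (eq_bigl (mem [:: o1; o2; o3; o4])) => [|o]; last by rewrite inE.
rewrite -big_uniq // !big_cons big_nil /= addr0.
by rewrite addrA e addrr_rV2 => /(_ erefl).
Qed.

Local Open Scope ring_scope.

(** * Comparison with the floor and the fractional part *)

Lemma Nfl_itv (R : realType) t :
  (Nfl R t)%:R <= Num.sqrt (2 ^+ t.+1 : R) + 2^-1 < (Nfl R t)%:R + 1.
Proof.
rewrite /Nfl; set x := Num.sqrt _ + _.
have h : 0 <= Num.floor x by rewrite floor_ge0 addr_ge0 ?sqrtr_ge0 ?invr_ge0.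
have E : (Num.floor x)%:~R = (`|Num.floor x|%N)%:R :> R by rewrite -[in LHS](gez0_abs h).
by rewrite -E -(intrD _ _ 1) floor_itv.
Qed.

(** The cross term of the square is at least [2 * c] since [c] is at most the root of A/B; the
    remaining term 1/B makes the inequality strict. *)
Lemma sqrt_gap (R : rcfType) (A B c z : R) : 0 <= A -> 0 < B -> 0 <= c -> c ^+ 2 * B <= A ->
  Num.sqrt A + (Num.sqrt B)^-1 <= z -> A + 2 * c < z ^+ 2.
Proof.
move=> A0 B0 c0 cBA hz.
have w0 : 0 < Num.sqrt B by rewrite sqrtr_gt0.
have cw : c <= Num.sqrt A * (Num.sqrt B)^-1.
  have cB0 : 0 <= c * Num.sqrt B by rewrite mulr_ge0 ?sqrtr_ge0.
  rewrite ler_pdivlMr // -(ger0_norm cB0) -sqrtr_sqr ler_sqrt //.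
  by rewrite exprMn sqr_sqrtr // ltW.
have := sqr_sqrtr A0; have := sqrtr_ge0 A; rewrite -invr_gt0 in w0.
move: (Num.sqrt A) (Num.sqrt B)^-1 w0 cw hz => r w w0 cw hz r0 <-.
nra.
Qed.

(** Excluding this single size suffices, as subsets of Sidon sets are Sidon, and it fixes the
    residue mod 3 in each branch of [lambda]. *)
Lemma sidon_card_neq (R : realType) t (M : {set 'rV['F_2]_t}) :
  (6 <= t)%N -> is_sidon M -> #|M| != (n_t R t).+1.
Proof.
move=> t6 sM; apply/eqP; rewrite /n_t /lambda /eps /acoef /bcoef.
have /andP [] := Nfl_itv R t; have rE : (2 ^+ t.+1 : R) = 2 * (2 ^ t)%:R.
  by rewrite exprS natrX.
set r := Num.sqrt _; set N := Nfl R t => hN1 hN2 hs.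
have A0 : 0 <= (2 ^+ t.+1 : R) by rewrite exprn_ge0.
have r0 : 0 <= r by apply: sqrtr_ge0.
have r2 : r ^+ 2 = 2 * (2 ^ t)%:R by rewrite -rE sqr_sqrtr.
have Q64 : (64 : R) <= (2 ^ t)%:R by rewrite (ler_nat R 64) (@leq_exp2l 2 6).
have N10 : (10 < N)%N by rewrite -(ltr_nat R); nra.
have cast p c : (p <= 2 * 2 ^ t + c)%N -> p%:R <= r ^+ 2 + c%:R.
  by rewrite -(ler_nat R) natrD natrM -r2.
have cast0 p : (p <= 2 * 2 ^ t)%N -> p%:R <= r ^+ 2 by rewrite -(ler_nat R) natrM -r2.
(* Squaring leaves the cross term [2 r / Num.sqrt (2 ^+ m) >= 2 c]. *)
have gap m c z : 0 <= c -> c ^+ 2 * 2 ^+ m <= (2 ^+ t.+1 : R) ->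
    r + (Num.sqrt (2 ^+ m))^-1 <= z -> r ^+ 2 + 2 * c < z ^+ 2.
  by move=> c0 h; rewrite r2 -rE; apply: sqrt_gap; rewrite ?exprn_gt0.
(* The ratios of 2^(t+1) to the three powers under the root are 2^5, 2^6 and 2^-6; [5], [8] and
   [8^-1] have squares at most these. *)
have gap4 z : r + (Num.sqrt (2 ^+ (t - 4)))^-1 <= z -> r ^+ 2 + 2 * 5 < z ^+ 2.
  apply: gap => //; rewrite (_ : t.+1 = (t - 4 + 5)%N) ?exprD; last lia.
  by have := exprn_ge0 (t - 4) (ler0n R 2); lra.
have gap5 z : r + (Num.sqrt (2 ^+ (t - 5)))^-1 <= z -> r ^+ 2 + 2 * 8 < z ^+ 2.
  apply: gap => //; rewrite (_ : t.+1 = (t - 5 + 6)%N) ?exprD; last lia.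
  by have := exprn_ge0 (t - 5) (ler0n R 2); lra.
have gap7 z : r + (Num.sqrt (2 ^+ (t + 7)))^-1 <= z -> r ^+ 2 + 2 * 8^-1 < z ^+ 2.
  apply: gap; rewrite ?invr_ge0 // (_ : (t + 7 = t.+1 + 6)%N) ?exprD; last lia.
  lra.
have hr : r ^+ 2 < N%:R ^+ 2 + N%:R + 4^-1 by nra.
have y10 : 11 <= N%:R :> R by rewrite (ler_nat R 11).
(* This settles the branches with [lambda] equal to 0: counting pairs alone would give N^2 + N + 2
   <= r^2, against [hr]. *)
have N1 : #|M| <> N.+1.
  move=> h; have := sidon_bound sM; rewrite h => /(_ ltac:(lia)) /cast0.
  by rewrite /= natrD natrM -natr1; lra.
set x : R := (#|M|)%:R.
have real0 k : #|M| = (3 * k)%N -> odd k -> (1 < k)%N -> x * (x + 2) + 2 <= r ^+ 2.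
  move=> h1 h2 h3; have := cast0 _ (sidon_bound_mod0_odd sM h1 h2 h3).
  by rewrite natrD natrM -[#|M|.+2]addn2 natrD.
(* The odd case holds without the 6, but both parities share the weaker bound, which all branches
   tolerate. *)
have real1 k : #|M| = (3 * k + 1)%N -> (1 < k)%N -> x * (x + 3) <= r ^+ 2 + 6.
  move=> h1 h3; case: (boolP (odd k)) => h2.
    have := cast0 _ (sidon_bound_mod1_odd sM h1 h2 h3).
    by rewrite natrM natrD; lra.
  by have := cast _ 6 (sidon_bound_mod1_even sM h1 h2 h3); rewrite natrM natrD.
have real2 k : #|M| = (3 * k + 2)%N -> (1 < k)%N -> x * (x + 1) <= r ^+ 2.
  move=> h1 h3; have := cast0 _ (sidon_bound_mod2 sM h1 (ltnW h3)).
  by rewrite natrM -[#|M|.+1]addn1 natrD.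
have real2e k : #|M| = (3 * k + 2)%N -> ~~ odd k -> (1 < k)%N -> x * (x + 4) <= r ^+ 2 + 3.
  by move=> h1 h2 h3; have := cast _ 3 (sidon_bound_mod2_even sM h1 h2 h3); rewrite natrM natrD.
move: hs; have := divn_eq (N - 4) 3; have := ltn_pmod (N - 4) (isT : 0 < 3)%N.
move: ((N - 4) %/ 3)%N ((N - 4) %% 3)%N => a b b3 eN.
have {}eN : N = (3 * a + 4 + b)%N by lia.
have a2 : (1 < a)%N by lia.
have eps_le z : (r + 2^-1 - N%:R <= 1 - z) = (r + z <= N%:R + 2^-1).
  by apply/idP/idP; lra.
(* Throughout, k = a + 1, so its parity is opposite to that of [a], and the size N + 1 - lambda is
   3k plus a residue that selects the bound. *)
rewrite !eps_le; move: b3 eN; case: b => [|[|[|//]]] _ eN /=; case: (boolP (odd a)) => oa /= => hs.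
- have xE : x = N%:R by rewrite /x hs; congr _%:R; lia.
  have := @real1 a.+1; rewrite xE => /(_ ltac:(rewrite hs eN; lia) ltac:(lia)); nra.
- case: ifP hs => [he|_] hs; last first.
    have xE : x = N%:R by rewrite /x hs; congr _%:R; lia.
    have := @real1 a.+1; rewrite xE => /(_ ltac:(rewrite hs eN; lia) ltac:(lia)); nra.
  have xE : N%:R = x + 1 by rewrite /x natr1 hs; congr _%:R; lia.
  have := @real0 a.+1 ltac:(rewrite hs eN; lia) oa ltac:(lia); have : r <= x + 1 by lra.
  by have : 0 <= x by []; nra.
- case: ifP hs => [he|_] hs; last first.
    have xE : x = N%:R by rewrite /x hs; congr _%:R; lia.
    have := @real2e a.+1; rewrite xE /= negbK => /(_ ltac:(rewrite hs eN; lia) oa ltac:(lia)); nra.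
  have xE : N%:R = x + 1 by rewrite /x natr1 hs; congr _%:R; lia.
  have := @real1 a.+1 ltac:(rewrite hs eN; lia) ltac:(lia); have := gap4 _ he; rewrite xE; nra.
- case: ifP hs => [he|_] hs.
    have xE : N%:R = x + 1 by rewrite /x natr1 hs; congr _%:R; lia.
    have := @real1 a.+1 ltac:(rewrite hs eN; lia) ltac:(lia); have := gap5 _ he; rewrite xE; nra.
  case: ifP hs => [he|_] hs.
    have xE : x = N%:R by rewrite /x hs; congr _%:R; lia.
    have := @real2 a.+1; rewrite xE => /(_ ltac:(rewrite hs eN; lia) ltac:(lia)).
    by have := gap7 _ he; nra.
  by apply: N1; rewrite hs subn0.
- have xE : N%:R = x + 1 by rewrite /x natr1 hs; congr _%:R; lia.
  have := @real2e a.+1 ltac:(rewrite hs eN; lia) _ ltac:(lia); rewrite /= negbK => /(_ oa).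
  by move: hr; rewrite xE; nra.
- by apply: N1; rewrite hs subn0.
Qed.

(** * The closed form for odd exponents *)

Lemma n_t_odd (R : realType) t : (6 <= t)%N -> odd t -> n_t R t = (2 ^ (t.+1 %/ 2) - 2)%N.
Proof.
move=> t6 ot; set m := (t.+1 %/ 2)%N; have em : t.+1 = (m * 2)%N by rewrite /m; lia.
have m4 : (4 <= m)%N by lia.
have rE : Num.sqrt (2 ^+ t.+1 : R) = (2 ^ m)%:R.
  by rewrite em exprM sqrtr_sqr ger0_norm ?exprn_ge0 // natrX.
(* The root is an integer, so the fractional part is exactly 1/2. *)
have NE : Nfl R t = (2 ^ m)%N.
  have /andP := Nfl_itv R t; rewrite rE => -[h1 h2].
  by apply/eqP; rewrite eqn_leq -ltnS -[X in _ && X]ltnS -!(ltr_nat R) -!natr1; lra.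
rewrite /n_t /eps /acoef /bcoef rE NE; congr (_ - _)%N.
rewrite (_ : _ + 2^-1 - _ = 2^-1); last by lra.
have P16 : (16 <= 2 ^ m)%N by rewrite (@leq_exp2l 2 4).
have P2 : odd (2 ^ m) = false by rewrite oddX orbF; lia.
have P3 : ~~ (3 %| 2 ^ m)%N by rewrite Euclid_dvdX.
have := divn_eq (2 ^ m - 4) 3; have := ltn_pmod (2 ^ m - 4) (isT : 0 < 3)%N.
move: ((2 ^ m - 4) %/ 3)%N ((2 ^ m - 4) %% 3)%N => a b b3 eN.
have h4 : 2^-1 <= 1 - (Num.sqrt (2 ^+ (t - 4)))^-1 :> R.
  have h : 2 <= Num.sqrt (2 ^+ (t - 4)) :> R.
    rewrite -[leLHS]ger0_norm // -sqrtr_sqr ler_wsqrtr // -!natrX ler_nat.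
    by rewrite leq_exp2l //; lia.
  have : (Num.sqrt (2 ^+ (t - 4)))^-1 <= 2^-1 :> R by rewrite lef_pV2 // posrE; lra.
  lra.
(* b = 2 would make 3 divide 2^m. As 2^m is even, [a] is even for b = 0 and odd for b = 1, and
   [lambda] is 2 in both cases. *)
rewrite /lambda h4 lexx; move: b3 eN; case: b => [|[|[|//]]] _ eN /=; case: ifP => // oa; lia.
Qed.

Theorem theorem4p3 (R : realType) (t : nat) (ht : (6 <= t)%N) :
  (~ exists C : 'M['F_2]_(n_t R t), is_code (n_t R t - t)%N 5 C) /\
  (s_max t <= (if odd t then 2 ^ (t.+1 %/ 2) - 2 else n_t R t))%N.
Proof.
split.
  by move=> [C /code_sidon [M /(sidon_card_neq R ht) /eqP]].
have -> : (if odd t then 2 ^ (t.+1 %/ 2) - 2 else n_t R t)%N = n_t R t.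
  by case: ifP => // ot; rewrite (n_t_odd R).
apply/bigmax_leqP => M /is_sidonP sM; rewrite leqNgt; apply/negP.
move=> /exists_subset_card [N sNM cN].
by have /eqP := sidon_card_neq R ht (sidonS sNM sM).
Qed.
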